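(* In the randomized ANY model with $n$ agents, asymptotically almost surely (as $n\to\infty$): 1. the number of calls until two fixed agents exchange their secrets is $\frac12 n\log n\cdot(1+o(1))$; 2. the number of calls until at least one of the agents becomes an expert is $n\log n\cdot(1+o(1))$; 3. the number of calls until a fixed agent becomes an expert is $n\log n\cdot(1+o(1))$; 4. the number of calls until all agents become experts is $\frac32 n\log n\cdot(1+o(1))$.
   Context: There are $n$ agents, each initially knowing a single distinct secret. Agents communicate by a sequence of calls between pairs of distinct agents; in each call the two agents exchange all secrets they currently know. An agent who knows all $n$ secrets is an expert. Two fixed agents have exchanged their secrets once each knows the secret of the other. In the randomized ANY model, each call is between a pair of distinct agents chosen uniformly at random among all $\binom n2$ pairs, independently of all previous calls (repetitions allowed). $\log$ is the natural logarithm. A statement ''$X=f(n)(1+o(1))$ a.a.s.'' means that for every $\delta>0$, $\mathbb P[(1-\delta)f(n)\le X\le(1+\delta)f(n)]\to1$ as $n\to\infty$. *)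

(* Defs.v *)
From HB Require Import structures.
From mathcomp Require Export all_boot all_order all_algebra finmap.
From mathcomp Require Export all_classical all_reals all_analysis.

Set Implicit Arguments.
Unset Strict Implicit.
Unset Printing Implicit Defensive.

Import Order.TTheory GRing.Theory Num.Theory.
Import numFieldNormedType.Exports.

Local Open Scope classical_set_scope.
Local Open Scope ring_scope.

(* The secret of agent i : 'I_n is identified with i. *)
Definition agent_pair (n : nat) := {e : {set 'I_n} | #|e| == 2%N}.

(* [knows c t i] is the set of secrets known to agent i after the first t calls
   c 0, ..., c (t - 1). *)
Fixpoint knows (n : nat) (c : nat -> agent_pair n) (t : nat) (i : 'I_n) :
    {set 'I_n} :=
  if t is s.+1 then
    if i \in val (c s) then (\bigcup_(j in val (c s)) knows c s j)%SET
    else knows c s i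
  else [set i]%SET.

Definition exchanged (n : nat) (a b : 'I_n) (c : nat -> agent_pair n)
    (t : nat) : bool :=
  (b \in knows c t a) && (a \in knows c t b).

Definition expert (n : nat) (i : 'I_n) (c : nat -> agent_pair n) (t : nat) :
    bool :=
  knows c t i == [set: 'I_n]%SET.

Definition some_expert (n : nat) (c : nat -> agent_pair n) (t : nat) : bool :=
  [exists i, expert i c t].

Definition all_experts (n : nat) (c : nat -> agent_pair n) (t : nat) : bool :=
  [forall i, expert i c t].

(* The least t such that Q c t, and +oo if there is none. *)
Definition calls_until (R : realType) (n : nat)
    (Q : (nat -> agent_pair n) -> nat -> bool) (c : nat -> agent_pair n) :
    \bar R :=
  ereal_inf [set (t%:R)%:E | t in [set t : nat | Q c t]].

(* Mutual independence of random variables with values in a finite type E,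
   all of whose subsets count as measurable. *)
Definition mutually_independent (R : realType) (d : measure_display)
    (T : measurableType d) (P : probability T R) (E : finType)
    (X : nat -> T -> E) : Prop :=
  forall (J : {fset nat}) (A : nat -> set E),
    P (\bigcap_(t in [set` J]) (X t @^-1` A t))
    = (\prod_(t <- J) P (X t @^-1` A t))%E.

Record any_model (R : realType) (n : nat) (d : measure_display)
    (T : measurableType d) (P : probability T R)
    (call : nat -> T -> agent_pair n) : Prop := AnyModel {
  any_measurable : forall (t : nat) (e : agent_pair n),
    measurable (call t @^-1` [set e]);
  any_uniform : forall (t : nat) (e : agent_pair n),
    P (call t @^-1` [set e]) = (('C(n, 2)%:R)^-1)%:E;
  any_independent : mutually_independent P call
}.

(* X = f (1 + o(1)) asymptotically almost surely, where X k is defined on its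
   own probability space (T k, P k). *)
Definition aas_asymptotic (R : realType) (d : nat -> measure_display)
    (T : forall k, measurableType (d k)) (P : forall k, probability (T k) R)
    (X : forall k, T k -> \bar R) (f : nat -> R) : Prop :=
  forall delta : R, 0 < delta ->
    P k [set w : T k | (((1 - delta) * f k)%:E <= X k w)%E /\
                       (X k w <= ((1 + delta) * f k)%:E)%E]
      @[k --> \oo] --> 1%E.

(* Main.v *)
Require Import Defs.
From mathcomp Require Import all_boot all_order all_algebra.
From mathcomp Require Import all_classical all_reals all_analysis.
From mathcomp Require Import ring lra zify.
Import Order.TTheory GRing.Theory Num.Theory.
Local Open Scope ring_scope.

Set Implicit Arguments.
Unset Strict Implicit.
Unset Printing Implicit Defensive.

(** Reading the calls backwards, the set of secrets known to agent [i] is the set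
    reached from [{i}] when each call [e] that meets the current set is added to
    it. Each tail estimate comes from a function [phi] of this set whose average
    over one uniform call is at most a constant multiple [rho] of its value, so
    that its average after [t] calls is at most [rho ^ t] times the initial value.
    Below, [k] is the size of the set, [N = 'C(n, 2)], probabilities are
    proportions among the [N ^ t] sequences of [t] calls, and [k (n - k) / N] is
    the probability of a growth.

    - [phi = [b notin S] prod_(1 <= m < k) (1 - x / m)], for [x < 1] close to [1],
      bounds the probability that [a] does not know [b] by
      [O (n ^ x exp (- 2 x t / n))]; a union bound over [1], [n] or [n ^ 2] pairs
      gives all upper bounds.
    - [phi = [b in S] + k / (eta n)] gives the lower bound for the exchange.
    - [phi = prod_(m < p) (k + m) / (n - k + 1 + m)] bounds the probability that [i]
      is an expert by [O (n ^ (- 2 p) exp (2 p t / n))]; with [p] large this beats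
      a union bound over [i], which gives the lower bound for the first expert.
    - For all agents to be experts, consider the set [V] of agents without a call
      during the last third of the time. The function [1 / (#|V| + 1)] shows that
      [V] is likely to be nonempty, and an agent of [V] must already have been an
      expert before. *)

(** * Averages over sequences of calls *)

Section CallSequences.
Variable E : finType.

Fixpoint call_seqs (t : nat) : seq (seq E) :=
  if t is s.+1 then [seq e :: l | e <- enum E, l <- call_seqs s] else [:: [::]].

Lemma mem_call_seqs (t : nat) (l : seq E) : (l \in call_seqs t) = (size l == t).
Proof.
elim: t l => [|t IH] [|e l] //=; first by apply/allpairsPdep => -[? [? []]].
rewrite eqSS -IH; apply/allpairsPdep/idP => [[e' [l' [_ l'P [_ ->]]]] // | lP].
by exists e, l; rewrite mem_enum.
Qed.

Lemma sum_call_seqsS (V : nmodType) (t : nat) (F : seq E -> V) :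
  \sum_(l <- call_seqs t.+1) F l =
  \sum_(e : E) \sum_(l <- call_seqs t) F (e :: l).
Proof. by rewrite big_allpairs_dep /= big_enum. Qed.

Lemma sum_call_seqs_cat (V : nmodType) (s t : nat) (F : seq E -> V) :
  \sum_(l <- call_seqs (s + t)) F l =
  \sum_(l1 <- call_seqs s) \sum_(l2 <- call_seqs t) F (l1 ++ l2).
Proof.
elim: s F => [|s IH] F; first by rewrite big_seq1.
rewrite addSn !sum_call_seqsS; apply: eq_bigr => e _.
by rewrite IH; apply: eq_bigr.
Qed.

Lemma size_call_seqs (t : nat) : size (call_seqs t) = (#|E| ^ t)%N.
Proof.
elim: t => [|t IH] //=.
by rewrite size_allpairs IH -cardE expnS.
Qed.

(** [foldr] applies the head of the sequence last, so summing over the head first yields one factor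
    [rho]. Sums replace averages, so this [rho] includes the factor [#|E|]. *)
Lemma sum_foldr_call_seqs_le (R : realDomainType) (S : Type) (inv : S -> Prop)
    (f : E -> S -> S) (phi : S -> R) (rho : R) (t : nat) (s : S) :
  (forall e s, inv s -> inv (f e s)) ->
  (forall s, inv s -> \sum_(e : E) phi (f e s) <= rho * phi s) -> 0 <= rho ->
  inv s -> \sum_(l <- call_seqs t) phi (foldr f s l) <= rho ^+ t * phi s.
Proof.
move=> invf le_rho rho_ge0 invs.
have invl l : inv (foldr f s l) by elim: l => //= e l; exact: invf.
elim: t => [|t IH]; first by rewrite big_seq1 mul1r.
rewrite sum_call_seqsS exchange_big /= exprS -mulrA.
apply: le_trans (ler_wpM2l rho_ge0 IH); rewrite mulr_sumr.
by apply: ler_sum => l _; exact: le_rho.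
Qed.

Lemma sum_nat_bool_count (R : pzSemiRingType) (t : nat) (Q : pred (seq E)) :
  \sum_(l <- call_seqs t) (Q l)%:R = (count Q (call_seqs t))%:R :> R.
Proof.
rewrite -sum1_count natr_sum [RHS]big_mkcond /=.
by apply: eq_bigr => l _; case: (Q l).
Qed.

(** Markov's inequality: where [Q] holds, [phi] is at least [c]. *)
Lemma count_foldr_call_seqs_le (R : realFieldType) (S : Type) (inv : S -> Prop)
    (f : E -> S -> S) (Q : pred S) (phi : S -> R) (rho c : R) (t : nat) (s : S) :
  (forall e s, inv s -> inv (f e s)) ->
  (forall s, inv s -> 0 <= phi s) -> (forall s, inv s -> Q s -> c <= phi s) ->
  (forall s, inv s -> \sum_(e : E) phi (f e s) <= rho * phi s) -> 0 <= rho ->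
  inv s ->
  (count (fun l => Q (foldr f s l)) (call_seqs t))%:R * c <= rho ^+ t * phi s.
Proof.
move=> invf phi_ge0 le_c le_rho rho_ge0 invs.
apply: le_trans (sum_foldr_call_seqs_le t invf le_rho rho_ge0 invs).
have invl l : inv (foldr f s l) by elim: l => //= e l; exact: invf.
rewrite -sum_nat_bool_count mulr_suml; apply: ler_sum => l _.
case: (boolP (Q _)) => Ql; first by rewrite mul1r le_c.
by rewrite mul0r phi_ge0.
Qed.

End CallSequences.

(** * Knowledge as a spreading process run backwards *)

Section Spread.
Variable n : nat.
Implicit Types (e : agent_pair n) (S : {set 'I_n}).

Lemma card_agent_pair : #|{: agent_pair n}| = 'C(n, 2).
Proof. by rewrite card_sig -[in RHS](card_ord n) -card_draws cardsE. Qed.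

(** Each unordered pair comes from two ordered ones, hence the factor 2. *)
Lemma sum_agent_pair (R : comPzRingType) (f : {set 'I_n} -> R) :
  (\sum_(e : agent_pair n) f (val e)) *+ 2 =
  \sum_(x : 'I_n) \sum_(y | y != x) f [set x; y]%SET.
Proof.
transitivity (\sum_(e : {set 'I_n} | #|e| == 2%N)
  \sum_(x in e) \sum_(y in e | y != x) f e).
  rewrite -(big_sub (fun e : {set 'I_n} => #|e| == 2%N) f) -sumrMnl.
  apply: eq_bigr => e /cards2P[x [y [xy ->]]].
  rewrite big_setU1 ?inE //= big_set1.
  rewrite (big_pred1 y); last first.
    move=> z; rewrite !inE andb_orl andbN /=.
    by case: (eqVneq z y) => [->|//]; rewrite eq_sym xy.
  rewrite (big_pred1 x); last first.
    move=> z; rewrite !inE andb_orl andbN orbF /=.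
    by case: (eqVneq z x) => [->|//]; rewrite xy.
  by rewrite mulr2n.
rewrite (exchange_big_dep xpredT) //=; apply: eq_bigr => x _.
rewrite (exchange_big_dep (fun y => y != x)) /=; last by move=> e y _ /andP[].
apply: eq_bigr => y yx; rewrite (big_pred1 [set x; y]%SET) // => e /=.
apply/idP/eqP => [/and3P[/andP[/eqP e2 xe] ye _] | ->].
  apply/esym/eqP; rewrite eqEcard cards2 eq_sym yx e2 andbT.
  by rewrite finset.subUset !finset.sub1set xe.
by rewrite cards2 !inE !eqxx (eq_sym x) yx orbT.
Qed.

(** One call read backwards: if [S] holds the agents whose knowledge after [e] reaches the final
    agent, [spread e S] holds those whose knowledge before [e] does. *)
Definition spread e S : {set 'I_n} :=
  if [disjoint val e & S] then S else (val e :|: S)%SET.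

(** A pair misses a union exactly when it misses both parts. This allows a process started from a
    pair to be split into those started from its two ends. *)
Lemma spreadU e S1 S2 :
  spread e (S1 :|: S2)%SET = (spread e S1 :|: spread e S2)%SET.
Proof.
rewrite /spread -!finset.setI_eq0 finset.setIUr finset.setU_eq0.
case: eqP => _; case: eqP => _ //=; apply/setP => x; rewrite !inE;
  by do !case: (_ \in _).
Qed.

Lemma spread_subset e S : S \subset spread e S.
Proof. by rewrite /spread; case: ifP => // _; rewrite finset.subsetUr. Qed.

Lemma foldr_spreadU (l : seq (agent_pair n)) S1 S2 :
  foldr spread (S1 :|: S2)%SET l =
  (foldr spread S1 l :|: foldr spread S2 l)%SET.
Proof. by elim: l => //= e l ->; rewrite spreadU. Qed.

Lemma spread1 e (i : 'I_n) :
  spread e [set i]%SET = if i \in val e then val e else [set i]%SET.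
Proof.
rewrite /spread disjoint_sym finset.disjoints1 if_neg.
by case: ifP => // ie; apply/finset.setUidPl; rewrite finset.sub1set.
Qed.

(** Induction on the last call, the first to act in the [foldr]: if it involves [i], it turns the
    singleton into its two ends, and [foldr_spreadU] recovers the union in [knows]. *)
Lemma knows_foldr (c : nat -> agent_pair n) (t : nat) (i : 'I_n) :
  knows c t i = foldr spread [set i]%SET (mkseq c t).
Proof.
elim: t i => // t IH i; rewrite mkseqS foldr_rcons spread1 [LHS]/=.
case: ifP => // _; case: (c t) => e /= /cards2P[x [y [xy ->]]].
by rewrite big_setU1 ?inE //= big_set1 !IH -foldr_spreadU.
Qed.

(** [S] changes only under a pair with exactly one end [x] in it, and then gains the other end
    [y]. *)
Lemma sum_spread (R : realFieldType) (phi : {set 'I_n} -> R) S :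
  \sum_(e : agent_pair n) (phi (spread e S) - phi S) =
  \sum_(x in S) \sum_(y in ~: S) (phi (y |: S)%SET - phi S).
Proof.
pose f (e : {set 'I_n}) :=
  phi (if [disjoint e & S] then S else (e :|: S)%SET) - phi S.
pose D y : R := phi (y |: S)%SET - phi S.
apply: (@mulIf _ 2%:R); rewrite ?pnatr_eq0 // !mulr_natr (sum_agent_pair f).
have absorb x : x \in S -> (x |: S)%SET = S.
  by move=> xS; apply/finset.setUidPr; rewrite finset.sub1set.
(* The increment is split by which end lies in [S]; over ordered pairs both terms have the same sum,
   by exchanging the ends. *)
have fE x y : f [set x; y]%SET =
    ((x \in S) && (y \notin S))%:R * D y + ((y \in S) && (x \notin S))%:R * D x.
  rewrite /f -finset.setI_eq0 finset.setIUl finset.setU_eq0 !finset.setI_eq0.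
  rewrite !finset.disjoints1 /D.
  case: (boolP (x \in S)) => xS; case: (boolP (y \in S)) => yS /=.
  - by rewrite -finset.setUA !absorb // subrr !mul0r addr0.
  - by rewrite mul1r mul0r addr0 finset.setUAC absorb // finset.setUC.
  - by rewrite mul1r mul0r add0r -finset.setUA absorb.
  - by rewrite subrr !mul0r addr0.
have sumE : \sum_x \sum_(y | y != x) ((x \in S) && (y \notin S))%:R * D y =
    \sum_(x in S) \sum_(y in ~: S) D y.
  rewrite [RHS]big_mkcond /=; apply: eq_bigr => x _; rewrite big_mkcond /=.
  case: (boolP (x \in S)) => xS; last by rewrite big1 // => y _; rewrite mul0r if_same.
  rewrite [RHS]big_mkcond /=; apply: eq_bigr => y _; rewrite inE.
  case: (boolP (y \in S)) => yS /=; first by rewrite mul0r if_same.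
  by rewrite mul1r eq_sym (memPn yS).
under eq_bigr do under eq_bigr do rewrite fE.
under eq_bigr do rewrite big_split /=.
rewrite big_split /= sumE mulr2n; congr (_ + _).
rewrite -sumE; under eq_bigr do rewrite big_mkcond /=.
rewrite exchange_big /=; apply: eq_bigr => y _; rewrite [RHS]big_mkcond /=.
by apply: eq_bigr => x _; rewrite eq_sym.
Qed.

End Spread.

(** * Multiplicative drift of the spreading process *)

Section SpreadCounts.
Variables (R : realType) (n : nat).
Implicit Types (S : {set 'I_n}) (l : seq (agent_pair n)).

Local Notation N := ('C(n, 2)%:R : R).

Lemma bin2_natr : N * 2 = n%:R * (n%:R - 1).
Proof.
rewrite -[2]/(2`!%:R) -natrM bin_ffact; case: n => [|m]; first by rewrite mul0r.
by rewrite ffactnSr ffactn1 natrM subn1 /= -natr1 addrK.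
Qed.

Lemma sum_agent_pair_const (c : R) : \sum_(e : agent_pair n) c = N * c.
Proof. by rewrite sumr_const card_agent_pair mulr_natl. Qed.

Lemma sum_set_const S (c : R) : \sum_(x in S) c = #|S|%:R * c.
Proof. by rewrite sumr_const mulr_natl. Qed.

Lemma sum_spreadE (phi : {set 'I_n} -> R) S :
  \sum_(e : agent_pair n) phi (spread e S) =
  N * phi S + \sum_(x in S) \sum_(y in ~: S) (phi (y |: S)%SET - phi S).
Proof.
rewrite -sum_spread sumrB sum_agent_pair_const; ring.
Qed.

Lemma spread_neq0 (e : agent_pair n) S : (0 < #|S|)%N -> (0 < #|spread e S|)%N.
Proof. by move=> S0; apply: leq_trans (subset_leq_card (spread_subset e S)). Qed.

Lemma cardsC_natr S : #|~: S|%:R = n%:R - #|S|%:R :> R.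
Proof.
rewrite finset.cardsCs finset.setCK card_ord natrB //.
by rewrite -[X in (_ <= X)%N]card_ord max_card.
Qed.

Lemma card_set_le S : #|S|%:R <= n%:R :> R.
Proof. by rewrite ler_nat -[X in (_ <= X)%N]card_ord max_card. Qed.

(** For k > 0 this is Gamma (k - x) / (Gamma (1 - x) Gamma k), of order k ^ (- x); its decrement
    from k to k + 1 is x / k times its value. *)
Definition damp (x : R) (k : nat) : R := \prod_(1 <= m < k) (1 - x / m%:R).

Lemma dampS (x : R) (k : nat) : (0 < k)%N -> damp x k.+1 = damp x k * (1 - x / k%:R).
Proof. by move=> k0; rewrite /damp big_nat_recr. Qed.

Lemma damp_factor_gt0 (x : R) (k : nat) : x < 1 -> (0 < k)%N -> 0 < 1 - x / k%:R.
Proof.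
move=> x1 k0; rewrite subr_gt0 ltr_pdivrMr ?ltr0n // mul1r.
by apply: lt_le_trans x1 _; rewrite ler1n.
Qed.

Lemma damp_gt0 (x : R) (k : nat) : x < 1 -> 0 < damp x k.
Proof.
move=> x1; rewrite /damp big_nat; apply: prodr_gt0 => m /andP[m0 _].
exact: damp_factor_gt0.
Qed.

Lemma damp_anti (x : R) (j k : nat) :
  0 <= x < 1 -> (0 < j)%N -> (j <= k)%N -> damp x k <= damp x j.
Proof.
move=> /andP[x0 x1] j0; elim: k => [|k IH]; first by case: j j0.
rewrite leq_eqVlt => /predU1P[->//|/[!ltnS] jk].
have k0 : (0 < k)%N by apply: leq_trans jk.
apply: le_trans (IH jk); rewrite dampS // ler_piMr //; first exact/ltW/damp_gt0.
by rewrite gerBl divr_ge0.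
Qed.

(** At size k without [b], the summed loss relative to [phi] is x (n - k) from [damp] plus k - x
    from the calls that add [b]. This exceeds x (n - 1) by k (1 - x) >= 0. *)
Lemma count_not_known_le (x : R) (a b : 'I_n) (t : nat) :
  0 < x < 1 -> (1 < n)%N ->
  (count (fun l => b \notin foldr (@spread n) [set a]%SET l)
     (call_seqs (agent_pair n) t))%:R * damp x n <= (N - x * (n%:R - 1)) ^+ t.
Proof.
move=> /andP[x0 x1] n1.
pose phi S : R := (b \notin S)%:R * damp x #|S|.
have phi1 : phi [set a]%SET <= 1.
  rewrite /phi cards1 /damp big_geq // mulr1.
  by case: (_ \notin _).
have rho0 : 0 <= N - x * (n%:R - 1).
  have := bin2_natr; have : 2 <= n%:R :> R by rewrite ler_nat.
  by move=> *; nra.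
apply: (@le_trans _ _ ((N - x * (n%:R - 1)) ^+ t * phi [set a]%SET)); last first.
  by rewrite ler_piMr // exprn_ge0.
apply: (count_foldr_call_seqs_le (inv := fun S => (0 < #|S|)%N)
  (Q := fun S : {set 'I_n} => b \notin S)).
- by move=> e S; exact: spread_neq0.
- by move=> S _; rewrite mulr_ge0 // ltW // damp_gt0.
- move=> S S0 bS; rewrite /phi bS mul1r damp_anti //; first by rewrite ltW.
  by rewrite -[X in (_ <= X)%N]card_ord max_card.
- move=> S S0; rewrite sum_spreadE.
  have [bS|bS] := boolP (b \in S).
    rewrite big1 => [|y _]; first by rewrite /phi bS !mul0r !mulr0 addr0.
    by rewrite big1 // => z _; rewrite /phi !inE bS orbT !mul0r subrr.
  (* Every new agent lowers [damp]; the new agent [b] moreover loses the entire remaining value. *)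
  have -> : \sum_(y in ~: S) (phi (y |: S)%SET - phi S) =
      #|~: S|%:R * (damp x #|S|.+1 - damp x #|S|) - damp x #|S|.+1.
    transitivity (\sum_(y in ~: S)
        ((damp x #|S|.+1 - damp x #|S|) - (y == b)%:R * damp x #|S|.+1)).
      apply: eq_bigr => y; rewrite inE => yS.
      rewrite /phi !inE negb_or bS andbT cardsU1 yS eq_sym.
      by case: eqP => _ /=; rewrite ?mul1r ?mul0r ?subr0 ?sub0r //; ring.
    rewrite sumrB sum_set_const.
    rewrite (bigD1 b) ?inE //= eqxx mul1r big1 ?addr0 // => y /andP[_ /negPf->].
    by rewrite mul0r.
  rewrite sum_set_const cardsC_natr dampS // /phi bS mul1r.
  have k0 : 1 <= #|S|%:R :> R by rewrite ler1n.
  have kn := card_set_le S.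
  have d0 := damp_gt0 #|S| x1.
  set k := #|S|%:R in k0 kn *; set d := damp _ _ in d0 *.
  have kV : k * (x / k) = x by rewrite mulrC divfK //; lra.
  have -> : k * ((n%:R - k) * (d * (1 - x / k) - d) - d * (1 - x / k)) =
    - d * (k * (x / k) * (n%:R - k) + k - k * (x / k)) by ring.
  rewrite kV -subr_ge0.
  have -> : (N - x * (n%:R - 1)) * d -
      (N * d + - d * (x * (n%:R - k) + k - x)) = d * (k * (1 - x)) by ring.
  by rewrite !mulr_ge0 //; lra.
- exact: rho0.
- by rewrite cards1.
Qed.

(** At most k pairs add [b], which is eta n times the term k / (eta n), and this term itself gains
    at most n times its value. Together the gain is at most (1 + eta) n [phi]. *)
Lemma count_known_le (eta : R) (a b : 'I_n) (t : nat) : 0 < eta -> a != b ->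
  (count (fun l => b \in foldr (@spread n) [set a]%SET l)
     (call_seqs (agent_pair n) t))%:R <=
  (N + (1 + eta) * n%:R) ^+ t * (eta * n%:R)^-1.
Proof.
move=> eta0 ab; set c := (eta * n%:R)^-1.
have n0 : 0 < n%:R :> R by rewrite ltr0n (leq_ltn_trans _ (ltn_ord a)).
have c0 : 0 < c by rewrite invr_gt0 mulr_gt0.
pose phi S : R := (b \in S)%:R + #|S|%:R * c.
have -> : c = phi [set a]%SET by rewrite /phi inE eq_sym (negPf ab) add0r cards1 mul1r.
rewrite -[X in X <= _]mulr1.
apply: (count_foldr_call_seqs_le (inv := fun=> True)
  (Q := fun S : {set 'I_n} => b \in S)) => //.
- by move=> S _; rewrite addr_ge0 // mulr_ge0 // ltW.
- by move=> S _ bS; rewrite /phi bS lerDl mulr_ge0 // ltW.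
- move=> S _; rewrite sum_spreadE mulrDl lerD2l.
  apply: (@le_trans _ _ (\sum_(x in S) ((n%:R - #|S|%:R) * c + 1))).
    apply: ler_sum => x _.
    apply: (@le_trans _ _ (\sum_(y in ~: S) (c + (y == b)%:R))).
      apply: ler_sum => y; rewrite inE => yS.
      rewrite /phi !inE cardsU1 yS add1n -natr1 eq_sym.
      by case: eqP => _ /=; case: (_ \in _) => /=; lra.
    rewrite big_split /= sum_set_const cardsC_natr lerD2l.
    have [bS|bS] := boolP (b \in S).
      rewrite big1 // => y; rewrite inE => yS; case: eqP => // yb.
      by rewrite yb bS in yS.
    rewrite (bigD1 b) ?inE //= eqxx big1 ?addr0 // => y /andP[_ /negPf->].
    by [].
  rewrite sum_set_const /phi.
  have cE : eta * n%:R * c = 1 by rewrite /c divff // gt_eqF // mulr_gt0.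
  have kn := card_set_le S; have k0 : 0 <= #|S|%:R :> R by [].
  apply: (@le_trans _ _ ((1 + eta) * n%:R * (#|S|%:R * c))); last first.
    by rewrite ler_wpM2l ?lerDr // mulr_ge0 ?ltW // addr_gt0.
  rewrite -subr_ge0.
  have -> : (1 + eta) * n%:R * (#|S|%:R * c) -
    #|S|%:R * ((n%:R - #|S|%:R) * c + 1) =
    #|S|%:R * #|S|%:R * c + #|S|%:R * (eta * n%:R * c - 1) by ring.
  by rewrite cE subrr mulr0 addr0 !mulr_ge0 // ltW.
- by rewrite addr_ge0 // mulr_ge0 // ltW // addr_gt0.
Qed.

(** * Rising factorials and the probability of being an expert *)

Definition rising (p k : nat) : R := \prod_(m < p) (k + m)%:R.

Lemma rising_gt0 (p k : nat) : (0 < k)%N -> 0 < rising p k.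
Proof. by move=> k0; apply: prodr_gt0 => m _; rewrite ltr0n addn_gt0 k0. Qed.

Lemma risingS (p k : nat) : rising p k.+1 * k%:R = rising p k * (k + p)%:R.
Proof.
rewrite /rising; elim: p => [|p IH]; first by rewrite !big_ord0 addn0.
rewrite !big_ord_recr /= mulrAC IH addSnnS; ring.
Qed.

Lemma expr_le_rising (p k : nat) : k%:R ^+ p <= rising p k.
Proof.
rewrite -[X in _ ^+ X](card_ord p) -prodr_const.
by apply: ler_prod => m _; rewrite ler0n ler_nat leq_addr.
Qed.

(** With j = n - k > 0, a growth multiplies [phi] by (k + p) (j + p) / (k j) and k j pairs cause
    one, so the drift is exactly p (n + p) [phi]. The square appears because [phi] goes from an
    initial value to its inverse at the full set. *)
Lemma count_expert_le (p : nat) (i : 'I_n) (t : nat) :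
  (count (fun l => foldr (@spread n) [set i]%SET l == [set: 'I_n]%SET)
     (call_seqs (agent_pair n) t))%:R <=
  (N + p%:R * (n%:R + p%:R)) ^+ t * (rising p 1 / n%:R ^+ p) ^+ 2.
Proof.
have n0 : (0 < n)%N by exact: leq_ltn_trans (leq0n i) (ltn_ord i).
have rn0 := rising_gt0 p n0.
have r10 := rising_gt0 p (ltn0Sn 0).
have np0 : 0 < n%:R ^+ p :> R by rewrite exprn_gt0 // ltr0n.
pose phi S : R := rising p #|S| / rising p (n - #|S|).+1.
have phi1 : phi [set i]%SET = rising p 1 / rising p n.
  by rewrite /phi cards1 subn1 prednK.
have rho0 : 0 <= N + p%:R * (n%:R + p%:R).
  by rewrite addr_ge0 // mulr_ge0 // addr_ge0.
apply: (@le_trans _ _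
  ((N + p%:R * (n%:R + p%:R)) ^+ t * (rising p 1 / rising p n) ^+ 2)); last first.
  apply: ler_wpM2l; first exact: exprn_ge0.
  apply: lerXn2r; rewrite ?nnegrE.
  - exact/divr_ge0/ltW/rn0/ltW.
  - exact/divr_ge0/ltW/np0/ltW.
  by rewrite ler_pM2l // lef_pV2 ?posrE // expr_le_rising.
rewrite expr2 mulrA -ler_pdivrMr ?divr_gt0 // invf_div -phi1.
apply: (count_foldr_call_seqs_le (inv := fun S => (0 < #|S|)%N)
  (Q := fun S : {set 'I_n} => S == [set: 'I_n]%SET)).
- by move=> e S; exact: spread_neq0.
- by move=> S S0; rewrite divr_ge0 // ltW // rising_gt0.
- by move=> S _ /eqP->; rewrite /phi cardsT card_ord subnn.
- move=> S S0; rewrite sum_spreadE mulrDl lerD2l.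
  (* The full set is treated separately: it cannot grow, so its drift is 0. *)
  have [J0|J0] := posnP #|~: S|.
    rewrite big1; last by move=> x _; rewrite big1 // => y; rewrite (cards0_eq J0) inE.
    by rewrite !mulr_ge0 ?addr_ge0 ?invr_ge0 // ltW // rising_gt0.
  have JE : (n - #|S|)%N = #|~: S| by rewrite [RHS]finset.cardsCs finset.setCK card_ord.
  have -> : \sum_(x in S) \sum_(y in ~: S) (phi (y |: S)%SET - phi S) =
      #|S|%:R * (#|~: S|%:R * (rising p #|S|.+1 / rising p #|~: S| - phi S)).
    rewrite -sum_set_const; apply: eq_bigr => x _.
    rewrite -sum_set_const; apply: eq_bigr => y; rewrite inE => yS.
    by rewrite /phi cardsU1 yS add1n subnS JE prednK.
  rewrite /phi JE.
  have nE : n%:R = #|S|%:R + #|~: S|%:R :> R by rewrite cardsC_natr; ring.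
  rewrite nE; have := risingS p #|S|; have := risingS p #|~: S|.
  have := rising_gt0 p S0; have := rising_gt0 p J0; have := rising_gt0 p (ltn0Sn #|~: S|).
  have : 0 < #|S|%:R :> R by rewrite ltr0n.
  have : 0 < #|~: S|%:R :> R by rewrite ltr0n.
  rewrite !natrD; move: (rising p #|S|) (rising p #|S|.+1) => a b.
  move: (rising p #|~: S|) (rising p #|~: S|.+1) => c d.
  move: #|S|%:R #|~: S|%:R p%:R => k J q J1 k1 d0 c0 a0 dE bE.
  have -> : b = a * (k + q) / k by rewrite -bE mulfK // gt_eqF.
  have -> : d = c * (J + q) / J by rewrite -dE mulfK // gt_eqF.
  rewrite le_eqVlt; apply/orP; left; apply/eqP; field.
  have : c * (J + q) != 0 by rewrite -dE mulf_neq0 // gt_eqF.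
  by rewrite mulf_eq0 negb_or => /andP[-> ->]; rewrite !gt_eqF.
- exact: rho0.
- by rewrite cards1.
Qed.

(** * Agents without a call *)

Definition uncalled (e : agent_pair n) S : {set 'I_n} := (S :\: val e)%SET.

Lemma foldr_spread_uncalled l (i : 'I_n) :
  i \in foldr uncalled [set: 'I_n]%SET l ->
  foldr (@spread n) [set i]%SET l = [set i]%SET.
Proof.
elim: l => //= e l IH; rewrite inE => /andP[ie /IH->].
by rewrite spread1 (negPf ie).
Qed.

(** With U = [#|V|] >= 2, the U (n - U) pairs with one end in [V] each raise [phi] by 1 / (U (U +
    1)), and the U (U - 1) / 2 pairs inside [V] by 2 / ((U - 1) (U + 1)). The sum is exactly n / (U
    + 1) = n [phi]. *)
Lemma count_uncalled0_le (t : nat) :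
  (count (fun l => foldr uncalled [set: 'I_n]%SET l == finset.set0)
     (call_seqs (agent_pair n) t))%:R <= (N + n%:R) ^+ t * (n%:R + 1)^-1.
Proof.
pose phi S : R := (#|S|%:R + 1)^-1.
have -> : (n%:R + 1)^-1 = phi [set: 'I_n]%SET by rewrite /phi cardsT card_ord.
rewrite -[X in X <= _]mulr1.
apply: (count_foldr_call_seqs_le (inv := fun=> True)
  (Q := fun S : {set 'I_n} => S == finset.set0)) => //.
- by move=> S _; rewrite invr_ge0 addr_ge0.
- by move=> S _ /eqP ->; rewrite /phi cards0 add0r invr1.
move=> V _.
pose f (e : {set 'I_n}) := phi (V :\: e)%SET - phi V.
have -> : \sum_(e : agent_pair n) phi (uncalled e V) =
    N * phi V + \sum_(e : agent_pair n) f (val e).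
  rewrite sumrB sum_agent_pair_const /uncalled; ring.
rewrite mulrDl lerD2l -(ler_pM2r (ltr0n R 2)) mulr_natr sum_agent_pair.
pose U : R := #|V|%:R.
(* [al] is the increment of [phi] when one end of the pair lies in [V], and [2 * al + ga] when both
   do. *)
pose al : R := U^-1 - (U + 1)^-1.
pose ga : R := (U - 1)^-1 - (U + 1)^-1 - 2 * al.
have fE x y : y != x -> f [set x; y]%SET =
    (x \in V)%:R * al + (y \in V)%:R * al + (x \in V)%:R * (y \in V)%:R * ga.
  move=> yx; rewrite /f /phi.
  have UE : U = (x \in V)%:R + (y \in V)%:R + #|V :\: [set x; y]|%:R.
    rewrite /U (cardsD1 x V) (cardsD1 y (V :\ x)) !inE yx /= finset.setDDl.
    by rewrite addnA !natrD.
  have -> : #|V :\: [set x; y]|%:R = U - (x \in V)%:R - (y \in V)%:R :> R.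
    by rewrite UE; ring.
  rewrite -/U /ga /al.
  by case: (x \in V); case: (y \in V) => /=; rewrite ?mul1r ?mul0r ?subr0 ?addr0 ?add0r;
    rewrite ?subrK ?subrr //; ring.
have n1 (x : 'I_n) : \sum_(y : 'I_n | y != x) 1 = n%:R - 1 :> R.
  have -> : n%:R = \sum_(y : 'I_n) 1 :> R by rewrite sumr_const card_ord.
  by rewrite [X in _ = X - _](bigD1 x) //= addrAC subrr add0r.
have UE (x : 'I_n) : \sum_(y : 'I_n | y != x) (y \in V)%:R = U - (x \in V)%:R :> R.
  have -> : U = \sum_(y : 'I_n) (y \in V)%:R.
    rewrite /U -sum1_card natr_sum big_mkcond /=.
    by apply: eq_bigr => y _; case: (y \in V).
  by rewrite [X in _ = X - _](bigD1 x) //= addrAC subrr add0r.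
have sE : \sum_x (x \in V)%:R = U.
  rewrite /U -sum1_card natr_sum [RHS]big_mkcond /=.
  by apply: eq_bigr => y _; case: (y \in V).
have -> : \sum_x \sum_(y | y != x) f [set x; y]%SET =
    2 * U * (n%:R - 1) * al + U * (U - 1) * ga.
  transitivity (\sum_(x : 'I_n) ((x \in V)%:R * ((n%:R - 1) * al) +
      (U - (x \in V)%:R) * al + (x \in V)%:R * (U - 1) * ga)).
    apply: eq_bigr => x _.
    transitivity (\sum_(y : 'I_n | y != x) (1 * ((x \in V)%:R * al) +
      (y \in V)%:R * (al + (x \in V)%:R * ga))).
      by apply: eq_bigr => y yx; rewrite fE //; ring.
    rewrite big_split /= -!mulr_suml n1 UE.
    by case: (x \in V) => /=; ring.
  rewrite !big_split /= -!mulr_suml !sE sumrB sE sumr_const card_ord.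
  by rewrite -mulr_natr; ring.
rewrite /phi -/U /ga /al.
(* For [#|V|] at most 1 some denominators vanish, so these cases are separate; for larger [V]
   equality holds. *)
have [V0|V0] := eqVneq V finset.set0.
  by rewrite /U V0 cards0 !mulr0 !mul0r addr0 !mulr_ge0 // invr_ge0.
have [V1|V1] := eqVneq #|V| 1%N.
  rewrite /U V1 subrr mulr0 mul0r addr0 invr1.
  have -> : (1 + 1)^-1 = 1 / 2 :> R by rewrite mul1r.
  by lra.
have U2 : 2 <= U by rewrite ler_nat; move: V0; rewrite -card_gt0; lia.
rewrite le_eqVlt; apply/orP; left; apply/eqP; field.
by rewrite !gt_eqF //; lra.
Qed.

(** The last [t] calls are fixed first. If they leave some [i] uncalled, then [i] must be an expert
    after the first [s] calls. As [i] depends only on the last calls, no union bound over agents is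
    paid. *)
Lemma count_all_experts_le (s t : nat) (B : R) : 0 <= B ->
  (forall i : 'I_n,
    (count (fun l => foldr (@spread n) [set i]%SET l == [set: 'I_n]%SET)
     (call_seqs (agent_pair n) s))%:R <= B) ->
  (count (fun l => [forall i, foldr (@spread n) [set i]%SET l == [set: 'I_n]%SET])
     (call_seqs (agent_pair n) (s + t)))%:R <=
  N ^+ s * (count (fun l => foldr uncalled [set: 'I_n]%SET l == finset.set0)
     (call_seqs (agent_pair n) t))%:R + N ^+ t * B.
Proof.
move=> B0 leB; rewrite -sum_nat_bool_count sum_call_seqs_cat exchange_big /=.
rewrite -sum_nat_bool_count mulr_sumr.
have -> : N ^+ t * B = \sum_(l <- call_seqs (agent_pair n) t) B.
  by rewrite big_const_seq count_predT iter_addr_0 size_call_seqs card_agent_pair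
    -natrX mulr_natl.
rewrite -big_split /=; apply: ler_sum => l2 _.
have [_|/set0Pn[i iV]] := eqVneq.
  rewrite mulr1 -[X in X <= _]addr0 lerD //.
  have -> : N ^+ s = \sum_(l <- call_seqs (agent_pair n) s) 1.
    by rewrite big_const_seq count_predT iter_addr_0 size_call_seqs card_agent_pair
      -natrX.
  by apply: ler_sum => l1 _; case: [forall _, _].
rewrite mulr0 add0r; apply: le_trans (leB i).
rewrite -sum_nat_bool_count; apply: ler_sum => l1 _.
case: forallP => // /(_ i).
by rewrite foldr_cat (foldr_spread_uncalled iV) => ->.
Qed.

End SpreadCounts.

(** * Asymptotic form of the bounds *)

Section Estimates.
Variable R : realType.

(** Convexity: after division by exp (x L), apply 1 + u <= exp u at u = - x L and u = (1 - x) L; the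
    linear terms cancel. *)
Lemma expR_chord (x L : R) : 0 <= x <= 1 -> expR (x * L) <= 1 - x + x * expR L.
Proof.
move=> /andP[x0 x1].
have e1 := expR_ge1Dx (- (x * L)); have e2 := expR_ge1Dx ((1 - x) * L).
have -> : 1 - x + x * expR L =
    expR (x * L) * ((1 - x) * expR (- (x * L)) + x * expR ((1 - x) * L)).
  rewrite mulrDr mulrCA -expRD addrN expR0 mulr1 (mulrCA _ x) -expRD.
  by congr (_ + _ * expR _); ring.
rewrite ler_peMr ?expR_ge0 //; nra.
Qed.

(** The induction is on [damp x n.+1], equal to 1 - x at n = 1. From m to m + 1 its new factor 1 - x
    / (m + 1) is at least (m / (m + 1)) ^ x, by the chord bound at L = ln (m / (m + 1)). *)
Lemma damp_ge (x : R) (n : nat) : 0 < x < 1 -> (0 < n)%N ->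
  (1 - x) * expR (- (x * ln n%:R)) <= damp x n.
Proof.
move=> /andP[x0 x1] n0.
have x01 : 0 <= x < 1 by rewrite ltW.
apply: (@le_trans _ _ (damp x n.+1)); last exact: damp_anti.
elim: n n0 => // -[_ _|n IH _].
  by rewrite ln1 mulr0 oppr0 expR0 /damp big_nat1 divr1 mulr1.
rewrite dampS //.
have xn : expR (x * (ln n.+1%:R - ln n.+2%:R)) <= 1 - x / n.+2%:R.
  apply: le_trans (expR_chord _ _) _; first by rewrite !ltW.
  rewrite expRD expRN !lnK ?posrE ?ltr0n //.
  rewrite -[n.+2%:R]natr1 le_eqVlt; apply/orP; left; apply/eqP; field.
  by rewrite gt_eqF //; lra.
apply: le_trans (ler_pM _ (expR_ge0 _) (IH isT) xn); last first.
  by rewrite mulr_ge0 ?expR_ge0 //; lra.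
by rewrite -mulrA -expRD ler_pM2l ?subr_gt0 // ler_expR; lra.
Qed.

Lemma exprD_le_expR (N kappa : R) (t : nat) : 0 < N -> 0 <= N + kappa ->
  (N + kappa) ^+ t <= N ^+ t * expR (t%:R * (kappa / N)).
Proof.
move=> N0 Nk; rewrite expRM_natl -exprMn; apply: lerXn2r; rewrite ?nnegrE //.
  by rewrite mulr_ge0 ?expR_ge0 // ltW.
apply: le_trans (ler_wpM2l (ltW N0) (expR_ge1Dx _)).
by rewrite mulrDr mulr1 mulrC divfK // gt_eqF.
Qed.

Lemma vanishing_expR_ln (C eps : R) : 0 < eps ->
  (C * expR (- (eps * ln k.+2%:R)) @[k --> \oo] --> 0)%classic.
Proof.
move=> eps0; rewrite -(mulr0 C); apply: cvgMl_tmp.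
have lny : (eps * ln (k.+2%:R : R) @[k --> \oo] --> +oo%R)%classic.
  apply/cvgryPge => A; have := nbhs_infty_ger (expR (A / eps)).
  apply: filterS => k Ak; rewrite mulrC -ler_pdivrMr //.
  rewrite -[A / eps]expRK ler_ln ?posrE ?expR_gt0 ?ltr0n //.
  by apply: le_trans Ak _; rewrite ler_nat !leqW.
exact: cvg_comp lny (@cvgr_expR R).
Qed.

Lemma vanishingD (u v : nat -> R) : (u k @[k --> \oo] --> 0 ->
  v k @[k --> \oo] --> 0 -> u k + v k @[k --> \oo] --> 0)%classic.
Proof. by move=> u0 v0; rewrite -[0]addr0; exact: cvgD. Qed.

(** * Tail bounds at times of order n log n *)

Variable n : nat.
Hypothesis n2 : (1 < n)%N.

Local Notation N := ('C(n, 2)%:R : R).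
Local Notation L := (ln n%:R : R).
Local Notation seqs := (call_seqs (agent_pair n)).

Lemma natr_ge2 : 2 <= n%:R :> R. Proof. by rewrite ler_nat. Qed.

Lemma natr_expR_ln : n%:R = expR L. Proof. by rewrite lnK // posrE ltr0n ltnW. Qed.

Lemma ln_natr_ge0 : 0 <= L. Proof. by rewrite ln_ge0 // ler1n ltnW. Qed.

Lemma ln_natr_le : L <= n%:R - 1.
Proof. by rewrite lerBrDl {2}natr_expR_ln expR_ge1Dx. Qed.

Lemma bin2_gt0 : 0 < N. Proof. by rewrite ltr0n bin_gt0. Qed.

Lemma bin2E : N = n%:R * (n%:R - 1) / 2.
Proof. by rewrite -bin2_natr mulfK. Qed.

(** The factor n ^ m prepares a union bound over n ^ m pairs; m = 0, 1, 2 give the constants 1/2, 1,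
    3/2. The [+ 1] allows for rounding and costs at most the constant exp 2. *)
Lemma count_not_known_asymp (delta : R) (m : nat) (a b : 'I_n) (t : nat) :
  0 < delta -> (1 + delta) * (m.+1%:R / 2 * (n%:R * L)) <= t%:R + 1 ->
  n%:R ^+ m * (count (fun l => b \notin foldr (@spread n) [set a]%SET l) (seqs t))%:R
  <= expR 2 * (1 + delta) / delta * expR (- (delta / (1 + delta) * L)) * N ^+ t.
Proof.
move=> d0 tle.
have n2' := natr_ge2; have L0 := ln_natr_ge0; have N0 := bin2_gt0.
(* With x (1 + delta) = 1, the factor exp (- 2 x t / n) is at most of order n ^ (- m - 1); times n ^
   m and n ^ x this leaves n ^ (- (1 - x)). *)
pose x := (1 + delta)^-1.
have d1 : 1 + delta != 0 by rewrite gt_eqF //; lra.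
have xd : x * (1 + delta) = 1 by rewrite mulVf.
have x0 : 0 < x by rewrite invr_gt0; lra.
have x1 : x < 1 by rewrite invf_lt1; lra.
have dE : delta / (1 + delta) = 1 - x.
  by rewrite /x -{1}[delta](addKr 1) mulrDl divff // addrC mulN1r.
clearbody x.
have x01 : 0 < x < 1 by rewrite x0.
have cnt := count_not_known_le a b t x01 n2.
have dmp := damp_ge x01 (ltnW n2).
have rho0 : 0 <= N + - (x * (n%:R - 1)) by rewrite bin2E; nra.
have := exprD_le_expR t N0 rho0 => rho.
have dmp0 := damp_gt0 n x1.
set c := _%:R in cnt *; have c0 : 0 <= c by rewrite ler0n.
have le1 : c * ((1 - x) * expR (- (x * L))) <=
    N ^+ t * expR (t%:R * (- (x * (n%:R - 1)) / N)).
  by apply: le_trans (le_trans cnt rho); rewrite ler_wpM2l.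
have -> : expR 2 * (1 + delta) / delta * expR (- (delta / (1 + delta) * L)) * N ^+ t
   = (N ^+ t * expR (2 - (1 - x) * L)) / (1 - x).
  have -> : expR 2 * (1 + delta) / delta = expR 2 / (1 - x).
    by rewrite -dE invf_div mulrA.
  by rewrite dE (expRD 2); ring.
rewrite ler_pdivlMr; last by lra.
have -> : n%:R ^+ m * c * (1 - x) =
    c * ((1 - x) * expR (- (x * L))) * expR (m%:R * L + x * L).
  rewrite [in LHS]natr_expR_ln -expRM_natl expRD expRN.
  field.
  by rewrite gt_eqF // expR_gt0.
apply: le_trans (ler_wpM2r (expR_ge0 _) le1) _.
rewrite -[X in X <= _]mulrA -expRD ler_pM2l ?exprn_gt0 // ler_expR.
have -> : t%:R * (- (x * (n%:R - 1)) / N) = - (2 * x * (t%:R / n%:R)).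
  rewrite bin2E; field; rewrite !gt_eqF //; lra.
have tn : (1 + delta) * (m.+1%:R / 2 * L) - 1 <= t%:R / n%:R.
  rewrite ler_pdivlMr; last by lra.
  by nra.
have : x * ((1 + delta) * (m.+1%:R / 2 * L) - 1) <= x * (t%:R / n%:R).
  by rewrite ler_pM2l.
rewrite mulrBr (mulrA x (1 + delta)) xd mul1r mulr1 -natr1.
by nra.
Qed.

(** With [eta] equal to [delta], the growth is of order n ^ ((1 + delta) (1 - delta)) at most, and
    division by delta n leaves n ^ (- delta ^ 2). *)
Lemma count_known_asymp (delta : R) (a b : 'I_n) (t : nat) :
  0 < delta < 1 -> a != b -> t%:R <= (1 - delta) * (1 / 2 * (n%:R * L)) ->
  (count (fun l => b \in foldr (@spread n) [set a]%SET l) (seqs t))%:R <=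
  expR 1 / delta * expR (- (delta ^+ 2 * L)) * N ^+ t.
Proof.
move=> /andP[d0 d1] ab tle.
have n2' := natr_ge2; have L0 := ln_natr_ge0; have N0 := bin2_gt0; have Ln := ln_natr_le.
apply: le_trans (count_known_le t d0 ab) _.
have rho0 : 0 <= N + (1 + delta) * n%:R by nra.
rewrite invfM [X in _ / X]natr_expR_ln -expRN.
have -> : expR 1 / delta * expR (- (delta ^+ 2 * L)) * N ^+ t =
  N ^+ t * expR (1 - delta ^+ 2 * L) / delta by rewrite expRD; ring.
rewrite mulrA mulrAC ler_pM2r ?invr_gt0 //.
apply: le_trans (ler_wpM2r (expR_ge0 _) (exprD_le_expR t N0 rho0)) _.
rewrite -[X in X <= _]mulrA -expRD ler_pM2l ?exprn_gt0 // ler_expR.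
have -> : t%:R * ((1 + delta) * n%:R / N) = (1 + delta) * 2 * (t%:R / (n%:R - 1)).
  rewrite bin2E; field; rewrite !gt_eqF //; lra.
(* Here n L <= (n - 1) (L + 1), because L <= n - 1. *)
have : t%:R / (n%:R - 1) <= (1 - delta) / 2 * (L + 1).
  rewrite ler_pdivrMr; last by lra.
  by nra.
by nra.
Qed.

Lemma count_expert_asymp (delta : R) (p : nat) (i : 'I_n) (t : nat) :
  0 < delta < 1 -> t%:R <= (1 - delta) * (n%:R * L) + 1 ->
  (count (fun l => foldr (@spread n) [set i]%SET l == [set: 'I_n]%SET) (seqs t))%:R
  <= rising R p 1 ^+ 2 * expR (4 * p%:R * (p%:R + 1)) *
     expR (- (2 * p%:R * delta * L)) * N ^+ t.
Proof.
move=> /andP[d0 d1] tle.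
have n2' := natr_ge2; have L0 := ln_natr_ge0; have N0 := bin2_gt0; have Ln := ln_natr_le.
apply: le_trans (count_expert_le R p i t) _.
have p0 : 0 <= p%:R :> R by [].
have rho0 : 0 <= N + p%:R * (n%:R + p%:R) by nra.
have -> : (rising R p 1 / n%:R ^+ p) ^+ 2 = rising R p 1 ^+ 2 * expR (- (2 * p%:R * L)).
  rewrite exprMn; congr (_ * _).
  rewrite {1}natr_expR_ln -expRM_natl -expRN -expRM_natl; congr expR; ring.
rewrite mulrCA [X in _ <= X]mulrC.
have -> : N ^+ t * (rising R p 1 ^+ 2 * expR (4 * p%:R * (p%:R + 1)) *
     expR (- (2 * p%:R * delta * L))) = rising R p 1 ^+ 2 *
     (N ^+ t * expR (4 * p%:R * (p%:R + 1) - 2 * p%:R * delta * L)).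
  by rewrite expRD; ring.
rewrite ler_wpM2l ?sqr_ge0 //.
apply: le_trans (ler_wpM2r (expR_ge0 _) (exprD_le_expR t N0 rho0)) _.
rewrite -[X in X <= _]mulrA -expRD ler_pM2l ?exprn_gt0 // ler_expR.
have -> : t%:R * (p%:R * (n%:R + p%:R) / N) =
    2 * p%:R * (t%:R / n%:R * ((n%:R + p%:R) / (n%:R - 1))).
  rewrite bin2E; field; rewrite !gt_eqF //; lra.
have t1 : t%:R / n%:R <= (1 - delta) * L + n%:R^-1.
  rewrite ler_pdivrMr; last by lra.
  by rewrite mulrDl mulVf; lra.
(* [v] is 1 + (p + 1) / (n - 1), so replacing it by 1 next to L costs only the constant p + 1. *)
set v := (n%:R + p%:R) / (n%:R - 1).
have v0 : 0 <= v by rewrite divr_ge0; lra.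
have Lv : L * v <= L + (p%:R + 1).
  rewrite mulrA ler_pdivrMr; last by lra.
  by nra.
have nv : n%:R^-1 * v <= p%:R + 1.
  rewrite mulrA ler_pdivrMr; last by lra.
  rewrite mulrDr mulVf; last by rewrite gt_eqF //; lra.
  have : n%:R^-1 * p%:R <= p%:R :> R by rewrite ler_piMl // invf_le1; lra.
  by nra.
have : t%:R / n%:R * v <= (1 - delta) * (L + (p%:R + 1)) + (p%:R + 1).
  apply: le_trans (ler_wpM2r v0 t1) _; rewrite mulrDl lerD // -mulrA ler_wpM2l //; lra.
move: (t%:R / n%:R * v) => w wle.
have : 2 * p%:R * w <= 2 * p%:R * ((1 - delta) * (L + (p%:R + 1)) + (p%:R + 1)).
  by rewrite ler_wpM2l // mulr_ge0.
by nra.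
Qed.

(** The growth exp (2 t / (n - 1)) is at most n ^ (1 - delta) up to a constant, against the initial
    value 1 / (n + 1). *)
Lemma count_uncalled0_asymp (delta : R) (t : nat) :
  0 < delta < 1 -> t%:R <= (1 - delta) * (1 / 2 * (n%:R * L)) ->
  (count (fun l => foldr (@uncalled n) [set: 'I_n]%SET l == finset.set0) (seqs t))%:R
  <= expR 1 * expR (- (delta * L)) * N ^+ t.
Proof.
move=> /andP[d0 d1] tle.
have n2' := natr_ge2; have L0 := ln_natr_ge0; have N0 := bin2_gt0; have Ln := ln_natr_le.
apply: le_trans (count_uncalled0_le R n t) _.
have rho0 : 0 <= N + n%:R by lra.
have n1 : (n%:R + 1)^-1 <= expR (- L).
  rewrite expRN -natr_expR_ln lef_pV2 ?posrE; lra.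
apply: le_trans (ler_pM _ _ (exprD_le_expR t N0 rho0) n1) _.
- exact: exprn_ge0.
- by rewrite invr_ge0; lra.
rewrite -expRD [X in _ <= X]mulrC -mulrA -expRD ler_pM2l ?exprn_gt0 // ler_expR.
have -> : t%:R * (n%:R / N) = 2 * (t%:R / (n%:R - 1)).
  rewrite bin2E; field; rewrite !gt_eqF //; lra.
have : t%:R / (n%:R - 1) <= (1 - delta) / 2 * (L + 1).
  rewrite ler_pdivrMr; last by lra.
  by nra.
by nra.
Qed.

End Estimates.

(** * Transfer to the random model *)

Section AnyModel.
Local Open Scope classical_set_scope.
Variables (R : realType) (n : nat) (d : measure_display) (T : measurableType d).
Variables (P : probability T R) (call : nat -> T -> agent_pair n).
Hypothesis Hcall : any_model P call.

Let cylinder (l : seq (agent_pair n)) : set T :=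
  [set w | mkseq (call^~ w) (size l) = l].

Lemma cylinderE (l : seq (agent_pair n)) (e0 : agent_pair n) :
  cylinder l = \bigcap_(s in [set` [fset s | s in iota 0 (size l)]%fset])
                  (call s @^-1` [set nth e0 l s]).
Proof.
apply/seteqP; split => w /=.
  move=> lE s /=; rewrite inE /= mem_iota => /andP[_ sl].
  by have := congr1 (fun m => nth e0 m s) lE; rewrite nth_mkseq.
move=> H; apply: (@eq_from_nth _ e0); rewrite size_mkseq // => s sl.
by rewrite nth_mkseq //; apply: H; rewrite /= inE /= mem_iota.
Qed.

Lemma measurable_cylinder (l : seq (agent_pair n)) : measurable (cylinder l).
Proof.
(* The empty sequence offers no default for [nth]; its cylinder is the whole space. *)
case: l => [|e0 l'].
  by rewrite /cylinder (_ : [set _ | _] = setT) //; apply/seteqP; split.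
rewrite (cylinderE _ e0); apply: fin_bigcap_measurable => // s _.
exact: any_measurable Hcall _ _.
Qed.

Lemma probability_cylinder (l : seq (agent_pair n)) :
  P (cylinder l) = (('C(n, 2)%:R ^+ size l)^-1)%:E.
Proof.
case: l => [|e0 l'].
  rewrite /cylinder (_ : [set _ | _] = setT) ?probability_setT ?invr1 //.
  by apply/seteqP; split.
rewrite (cylinderE _ e0).
rewrite (any_independent Hcall _ (fun s => [set nth e0 (e0 :: l') s])).
under eq_bigr do rewrite (any_uniform Hcall).
rewrite prodEFin big_const_seq count_predT -Monoid.iteropE.
by rewrite card_fseq undup_id ?iota_uniq // size_iota -exprVn.
Qed.

Let prefix_event (Q : pred (seq (agent_pair n))) (t : nat) : set T :=
  [set w | Q (mkseq (call^~ w) t)].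

Lemma prefix_eventE (Q : pred (seq (agent_pair n))) (t : nat) :
  prefix_event Q t =
  \bigcup_(l in [set` [fset l | l in [seq l <- call_seqs _ t | Q l]]%fset]) cylinder l.
Proof.
apply/seteqP; split => [w /= Qw|w [l /=]].
  exists (mkseq (call^~ w) t); last by rewrite /cylinder /= size_mkseq.
  by rewrite /= inE /= mem_filter Qw mem_call_seqs size_mkseq eqxx.
rewrite inE /= mem_filter mem_call_seqs => /andP[Ql /eqP <-].
by rewrite /cylinder /prefix_event /= => ->.
Qed.

Lemma measurable_prefix_event (Q : pred (seq (agent_pair n))) (t : nat) :
  measurable [set w | Q (mkseq (call^~ w) t)].
Proof.
rewrite -/(prefix_event Q t) prefix_eventE; apply: fin_bigcup_measurable => //.
by move=> l _; exact: measurable_cylinder.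
Qed.

(** Finite subadditivity over cylinders of equal probability; the tail estimates call for an upper
    bound only. *)
Lemma probability_prefix_event_le (Q : pred (seq (agent_pair n))) (t : nat) :
  (P [set w | Q (mkseq (call^~ w) t)] <=
   ((count Q (call_seqs (agent_pair n) t))%:R / 'C(n, 2)%:R ^+ t)%:E)%E.
Proof.
pose F := [fset l | l in [seq l <- call_seqs (agent_pair n) t | Q l]]%fset.
apply: (@le_trans _ _ (\sum_(l \in [set` F]) P (cylinder l))%E).
  apply: content_sub_fsum => //.
  - by move=> l _; exact: measurable_cylinder.
  - exact: measurable_prefix_event.
  - by rewrite -/(prefix_event Q t) prefix_eventE.
rewrite -fsbig_seq ?fset_uniq //.
have -> : (\sum_(l <- F) P (cylinder l) = \sum_(l <- F) (('C(n, 2)%:R ^+ t)^-1)%:E)%E.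
  rewrite big_seq [RHS]big_seq; apply: eq_bigr => l.
  rewrite inE /= mem_filter mem_call_seqs => /andP[_ /eqP <-].
  exact: probability_cylinder.
rewrite sumEFin lee_fin big_const_seq count_predT iter_addr_0 -[X in X <= _]mulr_natl.
rewrite ler_wpM2r ?invr_ge0 ?exprn_ge0 // ler_nat -size_filter.
by rewrite card_fseq size_undup.
Qed.

End AnyModel.

(** * First times and monotonicity in time *)

Section CallsUntil.
Variables (R : realType) (n : nat) (Q : (nat -> agent_pair n) -> nat -> bool).
Variable c : nat -> agent_pair n.

(** A number of calls is an integer, so only the floor of [s] matters, and monotonicity lets [Q] be
    tested at that single time. *)
Lemma calls_until_le (s : R) : 0 <= s ->
  (forall t t', (t <= t')%N -> Q c t -> Q c t') ->
  (calls_until R Q c <= s%:E)%E = Q c (Num.truncn s).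
Proof.
move=> s0 Qmono; apply/idP/idP => [|Qs].
  apply: contraTT => nQ; rewrite -ltNge.
  apply: (@lt_le_trans _ _ (((Num.truncn s).+1%:R)%:E)).
    by rewrite lte_fin; case/andP: (truncn_itv s0).
  apply: le_ereal_inf_tmp => _ [t Qt <-]; rewrite lee_fin ler_nat ltnNge.
  by apply: contra nQ => ts; exact: Qmono Qt.
apply: (@le_trans _ _ (((Num.truncn s)%:R)%:E)); last by rewrite lee_fin truncn_le.
by apply: ereal_inf_lbound; exists (Num.truncn s).
Qed.

Lemma le_calls_until (s : R) :
  (s%:E <= calls_until R Q c)%E <-> forall t, t%:R < s -> ~~ Q c t.
Proof.
split=> [le_s t ts|nQ].
  apply: contraL (le_s) => Qt; rewrite -ltNge.
  apply: (@le_lt_trans _ _ (t%:R%:E)); last by rewrite lte_fin.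
  by apply: ereal_inf_lbound; exists t.
apply: le_ereal_inf_tmp => _ [t Qt <-]; rewrite lee_fin leNgt.
by apply/negP => /nQ; rewrite Qt.
Qed.

End CallsUntil.

Section Monotonicity.
Variables (n : nat) (c : nat -> agent_pair n).

Lemma knows_mono (i : 'I_n) (t t' : nat) :
  (t <= t')%N -> knows c t i \subset knows c t' i.
Proof.
elim: t' => [|t' IH]; first by rewrite leqn0 => /eqP->.
rewrite leq_eqVlt => /predU1P[->//|/[!ltnS] /IH tt'].
apply: (fintype.subset_trans tt') => /=; case: ifP => // it.
exact: finset.bigcup_sup it.
Qed.

Lemma exchanged_mono (a b : 'I_n) (t t' : nat) :
  (t <= t')%N -> exchanged a b c t -> exchanged a b c t'.
Proof.
move=> tt' /andP[ba ab].
rewrite /exchanged (fintype.subsetP (knows_mono _ tt') _ ba).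
by rewrite (fintype.subsetP (knows_mono _ tt') _ ab).
Qed.

Lemma expert_mono (i : 'I_n) (t t' : nat) :
  (t <= t')%N -> expert i c t -> expert i c t'.
Proof.
by move=> tt' /eqP it; rewrite /expert -finset.subTset -it knows_mono.
Qed.

Lemma some_expert_mono (t t' : nat) :
  (t <= t')%N -> some_expert c t -> some_expert c t'.
Proof.
by move=> tt' /existsP[i it]; apply/existsP; exists i; exact: expert_mono it.
Qed.

Lemma all_experts_mono (t t' : nat) :
  (t <= t')%N -> all_experts c t -> all_experts c t'.
Proof.
by move=> tt' /forallP it; apply/forallP => i; exact: expert_mono (it i).
Qed.

End Monotonicity.

(** The union bound in counting form. *)
Lemma count_exists_le (T : Type) (I : finType) (Q : I -> pred T) (s : seq T) :
  (count (fun x => [exists i, Q i x]) s <= \sum_(i : I) count (Q i) s)%N.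
Proof.
elim: s => [|x s IH] /=; first by rewrite big1.
rewrite big_split /= leq_add //.
case: existsP => // -[i Qi].
by rewrite (bigD1 i) //= Qi.
Qed.

(** * Reduction to a lower and an upper tail count *)

Section AsymptoticallyAlmostSurely.
Local Open Scope classical_set_scope.
Variables (R : realType) (d : nat -> measure_display).
Variables (T : forall k, measurableType (d k)) (P : forall k, probability (T k) R).
Variable call : forall k, nat -> T k -> agent_pair k.+2.
Hypothesis Hcall : forall k, any_model (P k) (@call k).
Variables (Q : forall k, (nat -> agent_pair k.+2) -> nat -> bool).
Variables (Q' : forall k, pred (seq (agent_pair k.+2))) (f : nat -> R).

(** Outside the window, [Q'] holds already at the floor of (1 - delta) f or still fails at the floor
    of (1 + delta) f. The [+ 1] in the last hypothesis accounts for this floor. *)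
Lemma aas_asymptotic_calls_until :
  (forall k c t, Q c t = @Q' k (mkseq c t)) ->
  (forall k c t t', (t <= t')%N -> @Q k c t -> Q c t') ->
  (forall k, 0 <= f k) ->
  (forall delta : R, 0 < delta < 1 ->
    exists2 u : nat -> R, u k @[k --> \oo] --> 0 &
    forall k t, t%:R <= (1 - delta) * f k ->
      (count (@Q' k) (call_seqs _ t))%:R <= u k * 'C(k.+2, 2)%:R ^+ t) ->
  (forall delta : R, 0 < delta ->
    exists2 u : nat -> R, u k @[k --> \oo] --> 0 &
    forall k t, (1 + delta) * f k <= t%:R + 1 ->
      (count (fun l => ~~ @Q' k l) (call_seqs _ t))%:R
        <= u k * 'C(k.+2, 2)%:R ^+ t) ->
  aas_asymptotic P (fun k w => calls_until R (@Q k) (fun t => call t w)) f.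
Proof.
move=> QE Qmono f0 low up delta d0.
(* The lower tail is assumed for delta < 1 only; shrinking delta enlarges the range of [t]
   covered. *)
have [u1 u10 u1P] : exists2 u : nat -> R, u k @[k --> \oo] --> 0 &
    forall k t, t%:R <= (1 - Num.min delta (1 / 2)) * f k ->
      (count (@Q' k) (call_seqs _ t))%:R <= u k * 'C(k.+2, 2)%:R ^+ t.
  by apply: low; rewrite lt_min gt_min d0 /=; apply/andP; split; [|apply/orP; right]; lra.
have [u2 u20 u2P] := up _ d0.
pose t1 k := Num.truncn ((1 - delta) * f k).
pose t2 k := Num.truncn ((1 + delta) * f k).
pose E1 k := [set w : T k | Q' (mkseq ((@call k)^~ w) (t1 k))].
pose E2 k := [set w : T k | ~~ Q' (mkseq ((@call k)^~ w) (t2 k))].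
have mE1 k : measurable (E1 k) by exact: measurable_prefix_event (Hcall k) _ _.
have mE2 k : measurable (E2 k).
  exact: measurable_prefix_event (Hcall k) (fun l => ~~ Q' l) _.
pose X k (w : T k) := calls_until R (@Q k) (fun t => call t w).
pose G k := [set w : T k | (((1 - delta) * f k)%:E <= X k w)%E /\
                           (X k w <= ((1 + delta) * f k)%:E)%E].
have f1 k : 0 <= (1 + delta) * f k by rewrite mulr_ge0 //; lra.
(* This countable intersection of prefix events makes the event measurable, as passing to its
   complement requires. *)
have GE k : G k = ~` E2 k `&` \bigcap_(t in setT)
   [set w : T k | (fun l => (t%:R < (1 - delta) * f k) ==> ~~ Q' l)
      (mkseq ((@call k)^~ w) t)].
  have XE w : (X k w <= ((1 + delta) * f k)%:E)%E =
      Q' (mkseq ((@call k)^~ w) (t2 k)).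
    by rewrite /X calls_until_le // ?QE // => t t'; exact: Qmono.
  apply/seteqP; split=> w; rewrite /G /E2 /= XE.
    move=> [/le_calls_until lw uw]; split; first by apply/negP; rewrite negbK.
    by move=> t _ /=; apply/implyP => /lw; rewrite QE.
  move=> [/negP uw lw]; split; last by rewrite negbK in uw.
  apply/le_calls_until => t tf; rewrite QE.
  by have := lw t I => /implyP; exact.
have mG k : measurable (G k).
  rewrite GE; apply: measurableI; first exact: measurableC.
  apply: bigcap_measurable; first by exists 0%N.
  move=> t _; exact: (measurable_prefix_event (Hcall k)
    (fun l => (t%:R < (1 - delta) * f k) ==> ~~ Q' l)).
have GC k : ~` G k `<=` E1 k `|` E2 k.
  move=> w nG; have [|nE2] := pselect (E2 k w); first by right.
  left; apply/negPn/negP => nE1; apply: nG; rewrite GE; split => // t _ /=.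
  apply/implyP => tf; apply: contra nE1; rewrite -!QE.
  apply: Qmono; rewrite truncn_ge_nat; first exact: ltW.
  exact: le_trans (ltW tf).
have N0 k : 0 < 'C(k.+2, 2)%:R :> R by rewrite ltr0n bin_gt0.
have PE1 k : (P k (E1 k) <= (u1 k)%:E)%E.
  apply: le_trans (probability_prefix_event_le (Hcall k) _ _) _.
  rewrite lee_fin ler_pdivrMr ?exprn_gt0 //; apply: u1P.
  have mf : (1 - delta) * f k <= (1 - Num.min delta (1 / 2)) * f k.
    by rewrite ler_wpM2r // lerD2l lerN2 ge_min lexx.
  (* For delta > 1 the lower threshold may be negative; its truncation is then 0. *)
  have [le0|lt0] := leP 0 ((1 - delta) * f k).
    by apply: le_trans mf; rewrite truncn_le.
  rewrite /t1; have /truncn0Pn -> : ~~ (1 <= (1 - delta) * f k).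
    by rewrite -ltNge (lt_trans lt0).
  by rewrite mulr_ge0 // subr_ge0 ge_min; apply/orP; right; lra.
have PE2 k : (P k (E2 k) <= (u2 k)%:E)%E.
  apply: le_trans (probability_prefix_event_le (Hcall k) (fun l => ~~ Q' l) _) _.
  rewrite lee_fin ler_pdivrMr ?exprn_gt0 //; apply: u2P.
  by rewrite natr1 ltW //; case/andP: (truncn_itv (f1 k)).
apply: (@squeeze_cvge _ _ _ _ (fun k => (1 - (u1 k + u2 k))%:E)
  (fun k => P k (G k)) (fun=> 1%E)).
- apply: nearW => k; rewrite probability_le1 // andbT.
  have -> : P k (G k) = (1 - P k (~` G k))%E.
    by rewrite -probability_setC ?setCK //; exact: measurableC.
  rewrite EFinB leeB //.
  apply: le_trans (le_measure (P k) _ _ (GC k)) _.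
  - by rewrite inE; exact: measurableC.
  - by rewrite inE; exact: measurableU.
  apply: le_trans (measureU2 _ _ _) _ => //.
  by rewrite EFinD; apply: leeD; [exact: PE1|exact: PE2].
- apply/fine_cvgP; split; first exact: nearW.
  rewrite -[X in _ --> X]subr0; apply: cvgB; first exact: cvg_cst.
  exact: vanishingD.
- exact: cvg_cst.
Qed.

End AsymptoticallyAlmostSurely.

(** A union bound over the n secrets, paid for by one power of n in [count_not_known_asymp] at
    [m.+1]. *)
Lemma count_not_expert_asymp (R : realType) (delta : R) (m n : nat) (i : 'I_n) (t : nat) :
  (1 < n)%N -> 0 < delta ->
  (1 + delta) * (m.+2%:R / 2 * (n%:R * ln n%:R)) <= t%:R + 1 ->
  n%:R ^+ m *
    (count (fun l => foldr (@spread n) [set i]%SET l != [set: 'I_n]%SET)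
      (call_seqs (agent_pair n) t))%:R
  <= expR 2 * (1 + delta) / delta * expR (- (delta / (1 + delta) * ln n%:R)) *
     'C(n, 2)%:R ^+ t.
Proof.
move=> n2 d0 tle.
set u := (X in _ <= X).
have n0 : 0 < n%:R :> R by rewrite ltr0n ltnW.
have cntE : (count (fun l => foldr (@spread n) [set i]%SET l != [set: 'I_n]%SET)
      (call_seqs (agent_pair n) t) <=
    \sum_(j : 'I_n) count (fun l => j \notin foldr (@spread n) [set i]%SET l)
      (call_seqs (agent_pair n) t))%N.
  apply: leq_trans (count_exists_le _ _); apply: sub_count => l.
  by rewrite -finset.subTset => /fintype.subsetPn[j _ jl]; apply/existsP; exists j.
apply: (@le_trans _ _ (n%:R ^+ m * \sum_(j : 'I_n)
    (count (fun l => j \notin foldr (@spread n) [set i]%SET l)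
      (call_seqs (agent_pair n) t))%:R)).
  by rewrite ler_wpM2l ?exprn_ge0 // -natr_sum ler_nat.
rewrite mulr_sumr -(ler_pM2l n0) mulr_sumr.
apply: (@le_trans _ _ (\sum_(j : 'I_n) u)); last by rewrite sumr_const card_ord mulr_natl.
apply: ler_sum => j _; rewrite mulrA -exprS.
exact: count_not_known_asymp.
Qed.

(** * Assembling the four asymptotics *)

Section VanishingBounds.
Local Open Scope classical_set_scope.
Variable R : realType.

Local Notation nlogn k := (k.+2%:R * ln k.+2%:R : R).
Local Notation count_calls k Q t :=
  ((count Q (call_seqs (agent_pair k.+2) t))%:R : R).

(** The shape of the two tail hypotheses of [aas_asymptotic_calls_until], with [A] the range of
    times. *)
Definition vanishing_bound (A : nat -> nat -> Prop)
    (Q : forall k, pred (seq (agent_pair k.+2))) : Prop :=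
  exists2 u : nat -> R, u k @[k --> \oo] --> 0 &
    forall k t, A k t -> count_calls k (@Q k) t <= u k * 'C(k.+2, 2)%:R ^+ t.

Lemma vanishing_bound_expR (C eps : R) (A : nat -> nat -> Prop)
    (Q : forall k, pred (seq (agent_pair k.+2))) : 0 < eps ->
  (forall k t, A k t -> count_calls k (@Q k) t <=
    C * expR (- (eps * ln k.+2%:R)) * 'C(k.+2, 2)%:R ^+ t) ->
  vanishing_bound A Q.
Proof.
by move=> eps0 CP; exists (fun k => C * expR (- (eps * ln k.+2%:R)));
  [exact: vanishing_expR_ln|].
Qed.

Lemma nlogn_ge0 (k : nat) : 0 <= nlogn k.
Proof. by rewrite mulr_ge0 // ln_natr_ge0. Qed.

End VanishingBounds.

(* The k-th model has n = k + 2 agents: no call is possible with fewer than two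
   agents. *)
Theorem theorem6p5 (R : realType) (d : nat -> measure_display)
    (T : forall k, measurableType (d k)) (P : forall k, probability (T k) R)
    (call : forall k, nat -> T k -> agent_pair k.+2)
    (Hcall : forall k, any_model (P k) (call k))
    (a b : forall k, 'I_k.+2) (Hab : forall k, a k != b k) :
  let number_of_calls_until
      (Q : forall k, (nat -> agent_pair k.+2) -> nat -> bool) (k : nat)
      (w : T k) : \bar R :=
    calls_until R (Q k) (fun t => call k t w) in
  let nlogn (k : nat) : R := k.+2%:R * ln (k.+2%:R) in
  [/\ aas_asymptotic P
        (number_of_calls_until (fun k => exchanged (a k) (b k)))
        (fun k => 1 / 2 * nlogn k),
      aas_asymptotic P
        (number_of_calls_until (fun k => @some_expert k.+2))
        nlogn,
      aas_asymptotic P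
        (number_of_calls_until (fun k => expert (a k)))
        nlogn
    & aas_asymptotic P
        (number_of_calls_until (fun k => @all_experts k.+2))
        (fun k => 3 / 2 * nlogn k)].
Proof.
move=> number_of_calls_until nlogn.
pose K k (i : 'I_k.+2) := foldr (@spread k.+2) [set i]%SET.
have scaled_nlogn_ge0 (c : R) k : 0 <= c -> 0 <= c * nlogn k.
  by move=> c0; rewrite mulr_ge0 // nlogn_ge0.
have low2 (delta : R) : 0 < delta < 1 ->
    vanishing_bound R (fun k t => t%:R <= (1 - delta) * nlogn k)
      (fun k l => [exists i : 'I_k.+2, K k i l == [set: 'I_k.+2]%SET]).
  move=> d01; have /andP[d0 d1] := d01.
  (* Then p delta >= 1, so the union bound over n agents gives at most n n ^ (- 2 p delta) <= n ^ (-
     1), up to a constant. *)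
  pose p := (Num.truncn delta^-1).+1.
  have pd : 1 <= p%:R * delta.
    rewrite -ler_pdivrMr // mul1r ltW //.
    by case/andP: (truncn_itv (ltW (etrans (invr_gt0 delta) d0))).
  apply: (@vanishing_bound_expR R
    (rising R p 1 ^+ 2 * expR (4 * p%:R * (p%:R + 1))) 1) => // k t tle.
  apply: (@le_trans _ _ (\sum_(i : 'I_k.+2)
      (count (fun l => K k i l == [set: 'I_k.+2]%SET) (call_seqs _ t))%:R)).
    by rewrite -natr_sum ler_nat; exact: count_exists_le.
  have tle1 : t%:R <= (1 - delta) * nlogn k + 1 by lra.
  apply: (@le_trans _ _ (\sum_(i : 'I_k.+2) (rising R p 1 ^+ 2 *
      expR (4 * p%:R * (p%:R + 1)) * expR (- (2 * p%:R * delta * ln k.+2%:R)) *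
      'C(k.+2, 2)%:R ^+ t))).
    by apply: ler_sum => i _; exact: count_expert_asymp.
  rewrite sumr_const card_ord -[X in X <= _]mulr_natl mulrA ler_wpM2r ?exprn_ge0 //.
  rewrite mulrCA; apply: ler_wpM2l; first exact: mulr_ge0 (sqr_ge0 _) (expR_ge0 _).
  rewrite {1}(@natr_expR_ln R k.+2 isT) -expRD ler_expR.
  have := @ln_natr_ge0 R k.+2 isT; nra.
have low3 (delta : R) : 0 < delta < 1 ->
    vanishing_bound R (fun k t => t%:R <= (1 - delta) * nlogn k)
      (fun k l => K k (a k) l == [set: 'I_k.+2]%SET).
  move=> /low2[u u0 uP]; exists u => // k t /uP; apply: le_trans.
  by rewrite ler_nat; apply: sub_count => l Kl; apply/existsP; exists (a k).
have up3 (i : forall k, 'I_k.+2) (delta : R) : 0 < delta ->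
    vanishing_bound R (fun k t => (1 + delta) * nlogn k <= t%:R + 1)
      (fun k l => K k (i k) l != [set: 'I_k.+2]%SET).
  move=> d0; apply: (@vanishing_bound_expR R (expR 2 * (1 + delta) / delta)
    (delta / (1 + delta))) => [|k t tle]; first by rewrite divr_gt0 //; lra.
  rewrite -[X in X <= _]mul1r; apply: (@count_not_expert_asymp R delta 0) => //.
  by rewrite divff // mul1r.
split.
- apply: (aas_asymptotic_calls_until Hcall
    (Q' := fun k l => (b k \in K k (a k) l) && (a k \in K k (b k) l))).
  + by move=> k c t; rewrite /exchanged !knows_foldr.
  + by move=> k c t t'; exact: exchanged_mono.
  + by move=> k; apply: scaled_nlogn_ge0; lra.
  + move=> delta d01; have /andP[d0 d1] := d01.
    apply: (@vanishing_bound_expR R (expR 1 / delta) (delta ^+ 2)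
      (fun k t => t%:R <= (1 - delta) * (1 / 2 * nlogn k))); first by rewrite exprn_gt0.
    move=> k t tle.
    (* An exchange requires in particular that [a] knows [b]. *)
    apply: le_trans (count_known_asymp (isT : (1 < k.+2)%N) d01 (Hab k) tle).
    by rewrite ler_nat; apply: sub_count => l /andP[].
  + move=> delta d0.
    (* The leading 2 is the union bound over the two directions of the exchange. *)
    apply: (@vanishing_bound_expR R (2 * (expR 2 * (1 + delta) / delta))
      (delta / (1 + delta)) (fun k t => (1 + delta) * (1 / 2 * nlogn k) <= t%:R + 1)).
      by rewrite divr_gt0 //; lra.
    move=> k t tle; rewrite -!mulrA mulr_natl mulr2n !mulrA.
    have cntP (x y : 'I_k.+2) :=
      count_not_known_asymp (m := 0) (isT : (1 < k.+2)%N) x y d0 tle.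
    apply: le_trans (lerD (cntP (a k) (b k)) (cntP (b k) (a k))).
    rewrite !mul1r -natrD ler_nat -count_predUI.
    apply: leq_trans (leq_addr _ _); apply: sub_count => l.
    by rewrite /= negb_and.
- apply: (aas_asymptotic_calls_until Hcall
    (Q' := fun k l => [exists i : 'I_k.+2, K k i l == [set: 'I_k.+2]%SET])).
  + move=> k c t; rewrite /some_expert; apply: eq_existsb => i.
    by rewrite /expert knows_foldr.
  + by move=> k c t t'; exact: some_expert_mono.
  + by move=> k; exact: nlogn_ge0.
  + exact: low2.
  (* The first expert appears no later than the moment when the agent [ord0] becomes one. *)
  + move=> delta /(up3 (fun k => ord0))[u u0 uP]; exists u => // k t /uP.
    apply: le_trans; rewrite ler_nat; apply: sub_count => l.
    by rewrite negb_exists => /forallP.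
- apply: (aas_asymptotic_calls_until Hcall
    (Q' := fun k l => K k (a k) l == [set: 'I_k.+2]%SET)).
  + by move=> k c t; rewrite /expert knows_foldr.
  + by move=> k c t t'; exact: expert_mono.
  + by move=> k; exact: nlogn_ge0.
  + exact: low3.
  + exact: up3.
- apply: (aas_asymptotic_calls_until Hcall
    (Q' := fun k l => [forall i : 'I_k.+2, K k i l == [set: 'I_k.+2]%SET])).
  + move=> k c t; rewrite /all_experts; apply: eq_forallb => i.
    by rewrite /expert knows_foldr.
  + by move=> k c t t'; exact: all_experts_mono.
  + by move=> k; apply: scaled_nlogn_ge0; lra.
  + move=> delta d01; have /andP[d0 d1] := d01.
    apply: (@vanishing_bound_expR R
      (expR 1 + rising R 1 1 ^+ 2 * expR (4 * 1%:R * (1%:R + 1))) delta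
      (fun k t => t%:R <= (1 - delta) * (3 / 2 * nlogn k))) => //.
    (* The last third, about 1/2 n log n calls, leaves some agent uncalled; the first two thirds,
       about n log n, are too few for it. Rounding [r] down lengthens the first part, whence the
       [+ 1] in [sle]. *)
    move=> k t tle; pose r := (t %/ 3)%N.
    have tE : t = ((t - r) + r)%N by rewrite subnK // leq_div.
    have r3 : (3 * r <= t)%N by rewrite /r; lia.
    have s3 : (3 * (t - r) <= 2 * t + 3)%N by rewrite /r; lia.
    have rle : r%:R <= (1 - delta) * (1 / 2 * nlogn k).
      move: r3; rewrite -(ler_nat R) natrM; lra.
    have sle : (t - r)%:R <= (1 - delta) * nlogn k + 1.
      move: s3; rewrite -(ler_nat R) natrD !natrM; lra.
    (* Here p = 1 suffices, since no sum over agents has to be beaten. *)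
    have expert_le (i : 'I_k.+2) :=
      count_expert_asymp (isT : (1 < k.+2)%N) 1 i d01 sle.
    rewrite {1}tE; apply: le_trans (count_all_experts_le _ _ expert_le) _.
      apply: mulr_ge0 (exprn_ge0 _ _) => //; apply: mulr_ge0 (expR_ge0 _).
      exact: mulr_ge0 (sqr_ge0 _) (expR_ge0 _).
    have un := count_uncalled0_asymp (isT : (1 < k.+2)%N) d01 rle.
    have N0 (j : nat) : 0 <= 'C(k.+2, 2)%:R ^+ j :> R by rewrite exprn_ge0.
    apply: le_trans (lerD (ler_wpM2l (N0 (t - r)%N) un) (lexx _)) _.
    rewrite [in X in _ <= X]tE exprD.
    have L0 := @ln_natr_ge0 R k.+2 isT.
    have e2 : expR (- (2 * 1%:R * delta * ln k.+2%:R)) <=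
        expR (- (delta * ln k.+2%:R)) :> R.
      by rewrite ler_expR; nra.
    have := mulr_ge0 (N0 (t - r)%N) (N0 r).
    have : 0 <= rising R 1 1 ^+ 2 * expR (4 * 1%:R * (1%:R + 1)).
      exact: mulr_ge0 (sqr_ge0 _) (expR_ge0 _).
    move: e2 (_ ^+ 2 * _) (_ ^+ (t - r)%N) (_ ^+ r).
    move: (expR (- _)) (expR (- _)) => e' e ee' c x y c0 xy0.
    rewrite -subr_ge0.
    have -> : (expR 1 + c) * e' * (x * y) -
        (x * (expR 1 * e' * y) + y * (c * e * x)) = c * (e' - e) * (x * y) by ring.
    by rewrite mulr_ge0 // mulr_ge0 // subr_ge0.
  + move=> delta d0.
    apply: (@vanishing_bound_expR R (expR 2 * (1 + delta) / delta)
      (delta / (1 + delta)) (fun k t => (1 + delta) * (3 / 2 * nlogn k) <= t%:R + 1)).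
      by rewrite divr_gt0 //; lra.
    move=> k t tle; set v := (X in _ <= X).
    apply: (@le_trans _ _ (\sum_(i : 'I_k.+2)
        (count (fun l => K k i l != [set: 'I_k.+2]%SET) (call_seqs _ t))%:R)).
      rewrite -natr_sum ler_nat; apply: leq_trans (count_exists_le _ _).
      by apply: sub_count => l; rewrite negb_forall.
    (* The union bound over agents costs a second factor n, hence m = 1 and the constant 3/2. *)
    rewrite -(ler_pM2l (ltr0n R k.+2)) mulr_sumr.
    apply: (@le_trans _ _ (\sum_(i : 'I_k.+2) v)).
      apply: ler_sum => i _; rewrite -[X in X * _ <= _]expr1.
      exact: (@count_not_expert_asymp R delta 1).
    by rewrite sumr_const card_ord mulr_natl.
Qed.
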